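(* Completeness of the modal algebraic semantics implies completeness of the modal stable semantics. That is: if every formula valid in all algebraic models is provable, then every formula valid in all modal stable models is provable.
   Context: We consider the intuitionistic modal logic (of Dzik et al.) with two modalities, written ◆ (a filled/black diamond) and □, intended to be adjoint (◆ ⊣ □). Its algebraic models are Heyting algebras H equipped with two operators ◆, □ : H → H forming an adjunction ◆ ⊣ □ (i.e. ◆x ≤ y iff x ≤ □y). A stable frame is a distributive lattice (W, ⊑) with bottom 0 and top 1. A stable bimodule on W is a relation R ⊆ W × W such that w' ⊑ w R v ⊑ v' implies w' R v', and additionally: (i) w R v₁ and w R v₂ imply w R (v₁ ∧ v₂); (ii) w R 1; (iii) (w₁ ∧ w₂) R v implies there exist v₁, v₂ with v₁ ∧ v₂ ⊑ v, w₁ R v₁ and w₂ R v₂; (iv) 1 R v iff v = 1. A modal stable model (W, ⊑, R, V) consists of a stable frame, a stable bimodule R, and a valuation V assigning to each propositional variable a filter of W (a non-empty upper subset closed under finite meets). Satisfaction w ⊩ φ is defined as in Kripke semantics for atoms (w ∈ V(p)), ⊤, ∧ and → (w ⊩ φ → ψ iff for all v ⊒ w, v ⊩ φ implies v ⊩ ψ), while w ⊩ ⊥ iff w = 1; w ⊩ φ ∨ ψ iff there exist v₁, v₂ with v₁ ∧ v₂ ⊑ w, v₁ ⊩ φ and v₂ ⊩ ψ; w ⊩ ◆φ iff there exists v with v R w and v ⊩ φ; w ⊩ □φ iff for all v, w R v implies v ⊩ φ. A formula is valid in the stable semantics if it holds at every world of every modal stable model. *)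

(* Defs.v *)
From HB Require Import structures.
From mathcomp Require Import all_boot all_order.
From mathcomp Require Import boolp classical_sets.

Set Implicit Arguments.
Unset Strict Implicit.
Unset Printing Implicit Defensive.

Local Open Scope order_scope.

Inductive form (Var : Type) : Type :=
| Atom of Var
| Top
| Bot
| And of form Var & form Var
| Or of form Var & form Var
| Imp of form Var & form Var
| Dia of form Var
| Box of form Var.

Arguments Top {Var}.
Arguments Bot {Var}.

(* The logic IntGC of Dzik, Jarvinen and Kondo: a Hilbert system for
   intuitionistic propositional logic together with the two rules stating
   that Dia is left adjoint to Box.  Closure under uniform substitution is
   built in by the use of schemata. *)
Inductive provable (Var : Type) : form Var -> Prop :=
| pr_K a b : provable (Imp a (Imp b a))
| pr_S a b c :
    provable (Imp (Imp a (Imp b c)) (Imp (Imp a b) (Imp a c)))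
| pr_and_l a b : provable (Imp (And a b) a)
| pr_and_r a b : provable (Imp (And a b) b)
| pr_and a b : provable (Imp a (Imp b (And a b)))
| pr_or_l a b : provable (Imp a (Or a b))
| pr_or_r a b : provable (Imp b (Or a b))
| pr_or a b c :
    provable (Imp (Imp a c) (Imp (Imp b c) (Imp (Or a b) c)))
| pr_top : provable Top
| pr_bot a : provable (Imp Bot a)
| pr_mp a b : provable (Imp a b) -> provable a -> provable b
| pr_dia_box a b : provable (Imp (Dia a) b) -> provable (Imp a (Box b))
| pr_box_dia a b : provable (Imp a (Box b)) -> provable (Imp (Dia a) b).

(* The orders of MathComp lattices are boolean-valued.  This is no restriction
   on the lattices considered below: by the classical axioms of boolp, every
   type has a choiceType structure and every relation is decidable. *)

HB.mixin Record isHeyting (d : Order.disp_t) H of Order.TBLattice d H := {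
  himp : H -> H -> H;
  himpP : forall x y z : H, (x `&` y <= z) = (x <= himp y z)
}.

#[short(type="heytingType")]
HB.structure Definition Heyting (d : Order.disp_t) :=
  {H of isHeyting d H & Order.TBLattice d H}.

Definition adjunction (d : Order.disp_t) (H : heytingType d)
    (dia box : H -> H) : Prop :=
  forall x y : H, (dia x <= y) = (x <= box y).

Fixpoint eval (Var : Type) (d : Order.disp_t) (H : heytingType d)
    (dia box : H -> H) (v : Var -> H) (phi : form Var) : H :=
  match phi with
  | Atom p => v p
  | Top => \top
  | Bot => \bot
  | And a b => eval dia box v a `&` eval dia box v b
  | Or a b => eval dia box v a `|` eval dia box v b
  | Imp a b => himp (eval dia box v a) (eval dia box v b)
  | Dia a => dia (eval dia box v a)
  | Box a => box (eval dia box v a)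
  end.

Definition algebraically_valid (Var : Type) (phi : form Var) : Prop :=
  forall (d : Order.disp_t) (H : heytingType d) (dia box : H -> H),
  adjunction dia box ->
  forall v : Var -> H, eval dia box v phi = \top.

(* A stable frame is a tbDistrLatticeType. *)

Record stable_bimodule (d : Order.disp_t) (W : tbDistrLatticeType d)
    (R : W -> W -> Prop) : Prop := {
  bimodule : forall w' w v v' : W, w' <= w -> R w v -> v <= v' -> R w' v';
  bimodule_meetr : forall w v1 v2 : W, R w v1 -> R w v2 -> R w (v1 `&` v2);
  bimodule_topr : forall w : W, R w \top;
  bimodule_meetl : forall w1 w2 v : W, R (w1 `&` w2) v ->
    exists v1 v2 : W, [/\ v1 `&` v2 <= v, R w1 v1 & R w2 v2];
  bimodule_topl : forall v : W, R \top v <-> v = \top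
}.

Record lattice_filter (d : Order.disp_t) (W : tbDistrLatticeType d)
    (F : set W) : Prop := {
  lattice_filter_nonempty : (F !=set0)%classic;
  lattice_filter_upper : forall w v : W, w <= v -> F w -> F v;
  lattice_filter_meet : forall w v : W, F w -> F v -> F (w `&` v)
}.

Fixpoint sat (Var : Type) (d : Order.disp_t) (W : tbDistrLatticeType d)
    (R : W -> W -> Prop) (V : Var -> set W) (w : W) (phi : form Var) : Prop :=
  match phi with
  | Atom p => V p w
  | Top => True
  | Bot => w = \top
  | And a b => sat R V w a /\ sat R V w b
  | Or a b => exists v1 v2 : W,
      [/\ v1 `&` v2 <= w, sat R V v1 a & sat R V v2 b]
  | Imp a b => forall v : W, w <= v -> sat R V v a -> sat R V v b
  | Dia a => exists v : W, R v w /\ sat R V v a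
  | Box a => forall v : W, R w v -> sat R V v a
  end.

Definition stably_valid (Var : Type) (phi : form Var) : Prop :=
  forall (d : Order.disp_t) (W : tbDistrLatticeType d) (R : W -> W -> Prop)
    (V : Var -> set W),
  stable_bimodule R -> (forall p, lattice_filter (V p)) ->
  forall w : W, sat R V w phi.

(* Main.v *)
From HB Require Import structures.
From mathcomp Require Import all_boot all_order.
From mathcomp Require Import classical_sets.
Require Import Defs.

(** A Heyting algebra [H] with an adjunction [dia -| box] is itself a modal
    stable model when its order is reversed: the worlds are the elements of [H],
    [w] accesses [v] when [v <= dia w], and the valuation sends [p] to the
    elements below its value.  There [w] satisfies [phi] iff [w] lies below
    the value of [phi] in [H], so at [w = \top] stable validity forces that
    value to be [\top].  (Through [w |-> {x | w <= x}] this is the model of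
    principal filters of [H] ordered by inclusion; arbitrary filters are not
    needed.) *)

Set Implicit Arguments.
Unset Strict Implicit.
Unset Printing Implicit Defensive.

Import Order.Theory.
Local Open Scope order_scope.

(** Meeting with [z] is left adjoint to [himp z], so it preserves joins. *)
Lemma heyting_meetUl (d : Order.disp_t) (H : heytingType d) :
  @left_distributive H H Order.meet Order.join.
Proof.
move=> x y z; apply/le_anti; rewrite himpP leUx -!himpP leUl leUr /=.
by rewrite leUx !leI2 ?leUl ?leUr.
Qed.

(* An alias, since an instance on [H] itself would be a non-forgetful
   inheritance from [heytingType] to [distrLatticeType]. *)
Definition heyting_carrier (d : Order.disp_t) (H : heytingType d) : Type := H.

HB.instance Definition _ (d : Order.disp_t) (H : heytingType d) :=
  Order.TBLattice.on (heyting_carrier H).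

HB.instance Definition _ (d : Order.disp_t) (H : heytingType d) :=
  Order.Lattice_Meet_isDistrLattice.Build d (heyting_carrier H)
    (@heyting_meetUl d H).

Notation worlds H := ((heyting_carrier H)^d).

Lemma worlds_leE (d : Order.disp_t) (H : heytingType d) (w v : worlds H) :
  (w <= v) = ((v : H) <= w).
Proof. by []. Qed.

Lemma worlds_meetE (d : Order.disp_t) (H : heytingType d) (w v : worlds H) :
  w `&` v = (w : H) `|` v.
Proof. by []. Qed.

Lemma worlds_topE (d : Order.disp_t) (H : heytingType d) :
  (\top : worlds H) = (\bot : H).
Proof. by []. Qed.

Section DualModel.

Variables (d : Order.disp_t) (H : heytingType d) (dia box : H -> H).
Hypothesis adj : adjunction dia box.

Lemma adjunction_homo : {homo dia : x y / x <= y}.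
Proof. by move=> x y le_xy; rewrite adj (le_trans le_xy) -?adj. Qed.

Lemma adjunction_bot : dia \bot = \bot.
Proof. by apply/eqP; rewrite -lex0 adj le0x. Qed.

Lemma adjunction_join : {morph dia : x y / x `|` y}.
Proof.
move=> x y; apply/le_anti/andP; split.
  by rewrite adj leUx -!adj leUl leUr.
by rewrite leUx !adjunction_homo ?leUl ?leUr.
Qed.

Definition dual_access (w v : worlds H) : Prop := (v : H) <= dia w.

Definition dual_val (Var : Type) (v : Var -> H) (p : Var) : set (worlds H) :=
  fun w => (w : H) <= v p.

(** Under the reversed order, [bimodule_meetl] and [bimodule_topl] hold because [dia], a left
    adjoint, preserves binary joins and [\bot]. *)
Lemma dual_access_stable : stable_bimodule dual_access.
Proof.
rewrite /dual_access; split.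
- move=> w' w v v'; rewrite !worlds_leE => le_w Rwv le_v.
  by rewrite (le_trans le_v) // (le_trans Rwv) // adjunction_homo.
- by move=> w v1 v2 R1 R2; rewrite worlds_meetE leUx R1.
- by move=> w; rewrite worlds_topE le0x.
- move=> w1 w2 v; rewrite worlds_meetE adjunction_join => le_v.
  by exists (dia w1), (dia w2).
- move=> v; rewrite worlds_topE adjunction_bot lex0.
  by split=> /eqP.
Qed.

Lemma dual_val_filter (Var : Type) (v : Var -> H) (p : Var) :
  lattice_filter (dual_val v p).
Proof.
rewrite /dual_val; split.
- by exists (v p : worlds H).
- by move=> w w'; rewrite worlds_leE; apply: le_trans.
- by move=> w w' le_w le_w'; rewrite worlds_meetE leUx le_w.
Qed.

Lemma sat_dual (Var : Type) (v : Var -> H) (phi : form Var) (w : worlds H) :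
  sat dual_access (dual_val v) w phi <-> (w : H) <= eval dia box v phi.
Proof.
elim: phi w => [p|||a IHa b IHb|a IHa b IHb|a IHa b IHb|a IHa|a IHa] w /=.
- by [].
- by rewrite lex1.
- by rewrite worlds_topE lex0; split=> /eqP.
- by rewrite IHa IHb lexI; split=> /andP.
- split=> [[v1 [v2 []]]|le_w].
    rewrite worlds_leE worlds_meetE => le_w /IHa le1 /IHb le2.
    by rewrite (le_trans le_w) // leU2.
  (* By induction, the value of a subformula is the greatest element of [H] satisfying it, hence the
     canonical witness. *)
  exists (eval dia box v a : worlds H), (eval dia box v b : worlds H).
  by split; [rewrite worlds_leE worlds_meetE|apply/IHa|apply/IHb].
- rewrite -himpP; split=> [sat_ab|le_w u].
    (* [sat_ab] is used at the meet in [H] of [w] and the value of [a]. *)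
    by apply/IHb/sat_ab; [rewrite worlds_leE leIl|apply/IHa; rewrite leIr].
  rewrite worlds_leE => le_u /IHa le_ua; apply/IHb.
  by rewrite (le_trans _ le_w) // lexI le_u.
- split=> [[u [le_w /IHa le_u]]|le_w].
    by rewrite (le_trans le_w) // adjunction_homo.
  by exists (eval dia box v a : worlds H); split=> //; apply/IHa.
- rewrite -adj; split=> [sat_a|le_w u le_u]; last first.
    by apply/IHa; rewrite (le_trans le_u).
  (* [dia w] is the greatest element of [H] accessible from [w], so testing it alone suffices. *)
  by apply/(IHa (dia w))/sat_a; rewrite /dual_access.
Qed.

End DualModel.

Lemma stably_valid_algebraically (Var : Type) (phi : form Var) :
  stably_valid phi -> algebraically_valid phi.
Proof.
move=> valid_phi d H dia box adj v; apply/eqP; rewrite -le1x.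
apply/(sat_dual adj v phi (\top : H)); apply: valid_phi.
  exact: dual_access_stable adj.
exact: dual_val_filter.
Qed.

Theorem theorem4p3 (Var : Type) :
  (forall phi : form Var, algebraically_valid phi -> provable phi) ->
  (forall phi : form Var, stably_valid phi -> provable phi).
Proof.
by move=> complete phi /stably_valid_algebraically; apply: complete.
Qed.
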